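(* There exist absolute constants $c,d>0$ such that the following holds for every finite-precision Lanczos run of $k$ completed iterations (for arbitrary $n$, symmetric $A\in\mathbb{R}^{n\times n}$, nonzero $v\in\mathbb{R}^n$, $k_{\max}$, $k\le k_{\max}$ and $0\le\varepsilon\le 1/(20k_{\max})$, as defined in the context). Let $(\theta,y)$ be a unit eigenpair of $T_k$ (that is, $T_ky=\theta y$ and $\|y\|=1$). Then $$\operatorname{dist}(\theta,\operatorname{spec}(A))\le c\,k^d\bigl(\beta_k|e_k^{\mathsf T}y|+\varepsilon\|A\|\bigr).$$ In particular, if the recurrence terminates at step $k$, so that $\beta_k=0$, then every eigenvalue $\theta$ of $T_k$ satisfies $\operatorname{dist}(\theta,\operatorname{spec}(A))\le c\,k^d\,\varepsilon\|A\|$.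
   Context: Norms are Euclidean for vectors and spectral for matrices; $e_j$ denotes a standard basis vector; $\operatorname{spec}(A)$ is the set of eigenvalues of $A$; $\operatorname{dist}$ is the distance from a real number to a subset of $\mathbb{R}$. Finite-precision Lanczos run. Let $n,k_{\max}\ge1$ be integers, $A\in\mathbb{R}^{n\times n}$ symmetric, $v\in\mathbb{R}^n$ nonzero, and let the accuracy parameter satisfy $0\le\varepsilon\le 1/(20k_{\max})$. A run of $k$ completed iterations ($1\le k\le k_{\max}$) of the finite-precision symmetric Lanczos algorithm without reorthogonalization on $(A,v)$ consists of real vectors $v_j,u_j,w_j,z_j\in\mathbb{R}^n$ and real scalars $\alpha_j,\beta_j$ such that: $v_0=0$, $\beta_0=0$; $v_1$ satisfies $|v_1^{\mathsf T}v_1-1|\le\varepsilon$ and $\beta v_1=v+\Delta_0$ for some $\beta>0$ and some $\Delta_0$ with $\|\Delta_0\|\le\varepsilon\|v\|$; and for $j=1,\dots,k$ there are errors with $$u_j=Av_j+e^u_j,\quad \|e^u_j\|\le\varepsilon\|A\|\|v_j\|;$$ $$w_j=u_j-\beta_{j-1}v_{j-1}+e^w_j,\quad \|e^w_j\|\le\varepsilon(\|u_j\|+\beta_{j-1}\|v_{j-1}\|);$$ $$\alpha_j=v_j^{\mathsf T}w_j+e^\alpha_j,\quad |e^\alpha_j|\le\varepsilon\|v_j\|\|w_j\|;$$ $$z_j=w_j-\alpha_jv_j+e^z_j,\quad \|e^z_j\|\le\varepsilon(\|w_j\|+|\alpha_j|\|v_j\|).$$ If $z_j\ne0$ then $\beta_j>0$,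 $\beta_jv_{j+1}=z_j+\Delta_j$ with $\|\Delta_j\|\le\varepsilon\|z_j\|$, and $|v_{j+1}^{\mathsf T}v_{j+1}-1|\le\varepsilon$. If $z_j=0$ then $\beta_j=0$ and the algorithm terminates. Termination can occur only at $j=k$, so $\beta_1,\dots,\beta_{k-1}>0$. If the run terminates at step $k$, $v_{k+1}$ is not formed and by convention $\Delta_k=0$ and $\beta_kv_{k+1}=0$. $T_k\in\mathbb{R}^{k\times k}$ is the symmetric tridiagonal matrix with diagonal $\alpha_1,\dots,\alpha_k$ and off-diagonal entries $\beta_1,\dots,\beta_{k-1}$. *)

(* Defs.v *)
From HB Require Import structures.
From mathcomp Require Import all_boot all_order all_algebra.
From mathcomp Require Import all_classical all_reals all_analysis.
Import Order.TTheory GRing.Theory Num.Theory.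
Import numFieldNormedType.Exports.

Set Implicit Arguments.
Unset Strict Implicit.
Unset Printing Implicit Defensive.

Local Open Scope classical_set_scope.
Local Open Scope ring_scope.

(* MathComp-Analysis equips matrices with the max norm, hence the explicit
   Euclidean and spectral norms below. *)

Definition dotv (R : realType) (n : nat) (x y : 'cV[R]_n) : R :=
  (x^T *m y) 0 0.

Definition enorm (R : realType) (n : nat) (x : 'cV[R]_n) : R :=
  Num.sqrt (\sum_(i < n) x i 0 ^+ 2).

Definition specnorm (R : realType) (m n : nat) (A : 'M[R]_(m, n)) : R :=
  sup [set enorm (A *m x) | x in [set x : 'cV[R]_n | enorm x <= 1]].

Definition spec (R : realType) (n : nat) (A : 'M[R]_n) : set R :=
  [set a | eigenvalue A a].

(* One-based standard basis: [stdvec R k j] is e_j for 1 <= j <= k. *)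
Definition stdvec (R : realType) (k j : nat) : 'cV[R]_k :=
  \col_(i < k) (i.+1 == j)%:R.

(* One-based coefficients: the diagonal is alpha 1, ..., alpha k and the
   off-diagonal is beta 1, ..., beta k.-1. *)
Definition tridiag (R : realType) (k : nat) (alpha beta : nat -> R) :
    'M[R]_k :=
  \matrix_(i < k, j < k)
    if i == j :> nat then alpha i.+1
    else if i.+1 == j then beta i.+1
    else if j.+1 == i then beta j.+1
    else 0.

(* Only the values at the indices mentioned below are constrained; in
   particular vs k.+1 is arbitrary when the run terminates at step k, in which
   case beta k = 0. *)
Record lanczos_run (R : realType) (n k : nat) (eps : R)
    (A : 'M[R]_n) (v : 'cV[R]_n) (vs us ws zs : nat -> 'cV[R]_n)
    (alpha beta : nat -> R) : Prop := LanczosRun {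
  lanczos_v0 : vs 0%N = 0;
  lanczos_beta0 : beta 0%N = 0;
  lanczos_v1_norm : `|dotv (vs 1%N) (vs 1%N) - 1| <= eps;
  lanczos_v1 : exists b : R, exists D0 : 'cV[R]_n,
    [/\ 0 < b, enorm D0 <= eps * enorm v & b *: vs 1%N = v + D0];
  lanczos_u : forall j : nat, (1 <= j <= k)%N ->
    exists2 eu : 'cV[R]_n, us j = A *m vs j + eu &
      enorm eu <= eps * specnorm A * enorm (vs j);
  lanczos_w : forall j : nat, (1 <= j <= k)%N ->
    exists2 ew : 'cV[R]_n, ws j = us j - beta j.-1 *: vs j.-1 + ew &
      enorm ew <= eps * (enorm (us j) + beta j.-1 * enorm (vs j.-1));
  lanczos_alpha : forall j : nat, (1 <= j <= k)%N ->
    exists2 ea : R, alpha j = dotv (vs j) (ws j) + ea &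
      `|ea| <= eps * enorm (vs j) * enorm (ws j);
  lanczos_z : forall j : nat, (1 <= j <= k)%N ->
    exists2 ez : 'cV[R]_n, zs j = ws j - alpha j *: vs j + ez &
      enorm ez <= eps * (enorm (ws j) + `|alpha j| * enorm (vs j));
  lanczos_next : forall j : nat, (1 <= j <= k)%N -> zs j != 0 ->
    [/\ 0 < beta j,
        exists2 D : 'cV[R]_n, beta j *: vs j.+1 = zs j + D &
          enorm D <= eps * enorm (zs j)
      & `|dotv (vs j.+1) (vs j.+1) - 1| <= eps];
  lanczos_stop : forall j : nat, (1 <= j <= k)%N -> zs j = 0 -> beta j = 0;
  lanczos_stop_last : forall j : nat, (1 <= j <= k)%N -> zs j = 0 -> j = k
}.

(* Main.v *)
(* Write V for the matrix of computed vectors and (theta, y) for a unit eigenpair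
   of T_k.  The run satisfies A V = V T_k + beta_k v_(k+1) e_k^T + F with F of
   size poly(k) eps |A|, so if |V y| >= 1/2 then V y is an approximate
   eigenvector of A with residual beta_k |y_k| + poly(k) eps |A|.

   If |V y| < 1/2, then in |V y|^2 = sum_q y_q^2 |v_q|^2 + 2 sum_q y_q v_q . X_q,
   X_q = sum_(p < q) y_p v_p, the cross terms cannot be small.  Pick a large one,
   q = j + 1, and expand y' = (y_1, .., y_j) over an orthonormal eigenbasis (c_i)
   of T_j, with eigenvalues mu_i.  Two identities control each summand
   y_(j+1) (c_i . y') (c_i . r), where r_p = v_p . v_(j+1):
     (theta - mu_i) (c_i . y') = beta_j c_i(j) y_(j+1),
     beta_j c_i(j) (c_i . r)   = O(poly(k) eps |A|).
   The second is Paige's: loss of orthogonality only happens along converged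
   Ritz vectors.  A large summand therefore gives an eigenpair (mu, c) of T_j,
   j < k, for which both |theta - mu| and beta_j |c(j)| are O(poly(k) eps |A|),
   and one concludes by induction on k. *)

Require Import Defs.
From mathcomp Require Import all_boot all_order all_algebra.
From mathcomp Require Import all_classical all_reals all_analysis.
From mathcomp Require Import complex ring lra.
Import Order.TTheory GRing.Theory Num.Theory.
Import numFieldNormedType.Exports.

Set Implicit Arguments.
Unset Strict Implicit.
Unset Printing Implicit Defensive.

Local Open Scope ring_scope.

(** * Euclidean and spectral norms *)

Section Euclidean.
Variables (R : realType) (n : nat).
Implicit Types (x y z : 'cV[R]_n) (a : R).

Lemma dotvE x y : dotv x y = \sum_(i < n) x i 0 * y i 0.
Proof. by rewrite /dotv mxE; apply: eq_bigr => i _; rewrite mxE. Qed.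

Lemma dotvC x y : dotv x y = dotv y x.
Proof. by rewrite !dotvE; apply: eq_bigr => i _; rewrite mulrC. Qed.

Lemma dotvDl x y z : dotv (x + y) z = dotv x z + dotv y z.
Proof. by rewrite /dotv linearD mulmxDl mxE. Qed.

Lemma dotvZl a x z : dotv (a *: x) z = a * dotv x z.
Proof. by rewrite /dotv linearZ -scalemxAl mxE. Qed.

Lemma dotvDr x y z : dotv z (x + y) = dotv z x + dotv z y.
Proof. by rewrite dotvC dotvDl !(dotvC z). Qed.

Lemma dotvZr a x z : dotv z (a *: x) = a * dotv z x.
Proof. by rewrite dotvC dotvZl dotvC. Qed.

Lemma dotvNl x z : dotv (- x) z = - dotv x z.
Proof. by rewrite -scaleN1r dotvZl mulN1r. Qed.

Lemma dotvNr x z : dotv z (- x) = - dotv z x.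
Proof. by rewrite dotvC dotvNl dotvC. Qed.

Lemma dotv0l x : dotv 0 x = 0.
Proof. by rewrite -(scale0r 0) dotvZl mul0r. Qed.

Lemma dotv0r x : dotv x 0 = 0.
Proof. by rewrite dotvC dotv0l. Qed.

Definition dotvP := (dotvDl, dotvDr, dotvNl, dotvNr, dotvZl, dotvZr).

Lemma enorm_ge0 x : 0 <= enorm x.
Proof. exact: sqrtr_ge0. Qed.

Lemma enorm_sqr x : enorm x ^+ 2 = dotv x x.
Proof.
rewrite dotvE /enorm sqr_sqrtr; last by apply: sumr_ge0 => i _; exact: sqr_ge0.
by apply: eq_bigr => i _; rewrite expr2.
Qed.

Lemma dotvv_ge0 x : 0 <= dotv x x.
Proof. by rewrite -enorm_sqr sqr_ge0. Qed.

Lemma dotvv_eq0 x : (dotv x x == 0) = (x == 0).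
Proof.
apply/idP/eqP => [|->]; last by rewrite dotv0l.
rewrite dotvE psumr_eq0; last by move=> i _; rewrite -expr2 sqr_ge0.
move=> /allP h; apply/colP => i; rewrite mxE.
by have := h i (mem_index_enum _); rewrite /= mulf_eq0 orbb => /eqP.
Qed.

Lemma enorm_eq0 x : (enorm x == 0) = (x == 0).
Proof. by rewrite -dotvv_eq0 -enorm_sqr sqrf_eq0. Qed.

Lemma enorm0 : enorm (0 : 'cV[R]_n) = 0.
Proof. by apply/eqP; rewrite enorm_eq0. Qed.

Lemma enormZ a x : enorm (a *: x) = `|a| * enorm x.
Proof.
apply: (@pexpIrn _ 2) => //; rewrite ?nnegrE ?mulr_ge0 ?enorm_ge0 //.
by rewrite exprMn !enorm_sqr dotvZl dotvZr mulrA real_normK ?num_real // expr2.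
Qed.

Lemma enormN x : enorm (- x) = enorm x.
Proof. by rewrite -scaleN1r enormZ normrN1 mul1r. Qed.

Lemma cauchy_schwarz_dotv x y : `|dotv x y| <= enorm x * enorm y.
Proof.
wlog : x / 0 <= dotv x y => [H|H].
  case: (leP 0 (dotv x y)) => [/H //|lt0].
  by have := H (- x); rewrite dotvNl normrN enormN; apply; lra.
rewrite ger0_norm //.
have h := dotvv_ge0 (enorm y *: x - enorm x *: y).
rewrite !dotvP -!enorm_sqr (dotvC y x) in h.
have [x0|xn0] := eqVneq (enorm x) 0.
  by move/eqP: x0; rewrite enorm_eq0 => /eqP ->; rewrite dotv0l enorm0 mul0r.
have [y0|yn0] := eqVneq (enorm y) 0.
  by move/eqP: y0; rewrite enorm_eq0 => /eqP ->; rewrite dotv0r enorm0 mulr0.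
have xp : 0 < enorm x by rewrite lt_neqAle eq_sym xn0 enorm_ge0.
have yp : 0 < enorm y by rewrite lt_neqAle eq_sym yn0 enorm_ge0.
have xyp := mulr_gt0 xp yp.
rewrite -(ler_pM2l xyp); lra.
Qed.

Lemma enormD x y : enorm (x + y) <= enorm x + enorm y.
Proof.
rewrite -ler_sqr ?nnegrE ?addr_ge0 ?enorm_ge0 // enorm_sqr !dotvP.
rewrite sqrrD !enorm_sqr (dotvC y x).
have := le_trans (ler_norm _) (cauchy_schwarz_dotv x y); lra.
Qed.

Lemma enormB x y : enorm (x - y) <= enorm x + enorm y.
Proof. by rewrite -(enormN y) enormD. Qed.

Lemma enorm_sum (I : Type) (r : seq I) (P : pred I) (F : I -> 'cV[R]_n) :
  enorm (\sum_(i <- r | P i) F i) <= \sum_(i <- r | P i) enorm (F i).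
Proof.
elim/big_rec2: _ => [|i y1 y2 _ h]; first by rewrite enorm0.
by apply: le_trans (enormD _ _) _; rewrite lerD2l.
Qed.

Lemma normr_coef_le_enorm x i : `|x i 0| <= enorm x.
Proof.
rewrite -ler_sqr ?nnegrE ?enorm_ge0 // real_normK ?num_real // enorm_sqr dotvE.
rewrite (bigD1 i) //= -expr2 lerDl; apply: sumr_ge0 => j _.
by rewrite -expr2 sqr_ge0.
Qed.

End Euclidean.

Lemma dotv_mull (R : realType) m n (A : 'M[R]_(m, n)) x y :
  dotv (A *m x) y = dotv x (A^T *m y).
Proof. by rewrite /dotv trmx_mul mulmxA. Qed.

(** Without an upper bound the [sup] defining [specnorm] would carry no information. The coordinates
    of x are at most 1 in absolute value, so A x is no longer than the columns of A put together. *)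
Lemma specnorm_has_ub (R : realType) m n (A : 'M[R]_(m, n)) :
  has_ubound [set enorm (A *m x) | x in [set x : 'cV[R]_n | enorm x <= 1]].
Proof.
exists (\sum_(j < n) enorm (col j A)) => _ [x /= x1 <-].
have -> : A *m x = \sum_j x j 0 *: col j A.
  apply/colP => i; rewrite !mxE summxE; apply: eq_bigr => j _.
  by rewrite !mxE mulrC.
apply: le_trans (enorm_sum _ _ _) _; apply: ler_sum => j _.
rewrite enormZ -[leRHS]mul1r ler_wpM2r ?enorm_ge0 //.
exact: le_trans (normr_coef_le_enorm _ _) x1.
Qed.

Lemma enorm_mulmx_le (R : realType) m n (A : 'M[R]_(m, n)) x :
  enorm (A *m x) <= specnorm A * enorm x.
Proof.
have [->|xn0] := eqVneq x 0; first by rewrite mulmx0 !enorm0 mulr0.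
have xp : 0 < enorm x by rewrite lt_neqAle eq_sym enorm_eq0 xn0 enorm_ge0.
have -> : A *m x = enorm x *: (A *m ((enorm x)^-1 *: x)).
  by rewrite -scalemxAr scalerA mulfV ?gt_eqF // scale1r.
rewrite enormZ gtr0_norm // mulrC ler_wpM2r ?enorm_ge0 //.
apply: sup_upper_bound.
  split; last exact: specnorm_has_ub.
  by exists (enorm (A *m 0)); exists 0; rewrite /= ?enorm0.
exists ((enorm x)^-1 *: x) => //=.
by rewrite enormZ ger0_norm ?invr_ge0 ?enorm_ge0 // mulVf ?gt_eqF.
Qed.

Lemma specnorm_ge0 (R : realType) m n (A : 'M[R]_(m, n)) : 0 <= specnorm A.
Proof.
apply: sup_upper_bound.
  split; last exact: specnorm_has_ub.
  by exists (enorm (A *m 0)); exists 0; rewrite /= ?enorm0.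
by exists 0; rewrite /= ?mulmx0 ?enorm0.
Qed.

(** * Spectral theorem for real symmetric matrices *)

Section Spectral.
Variable R : realType.

(* For a complex eigenvector x + iy with eigenvalue a + ib, symmetry gives
   b (|x|^2 + |y|^2) = 0. *)
Lemma symmetric_unit_eigenvector n (A : 'M[R]_n) : (0 < n)%N -> A^T = A ->
  exists (a : R) (s : 'cV[R]_n), A *m s = a *: s /\ enorm s = 1.
Proof.
move=> n0 symA.
suff [a [s [As sn0]]] : exists a (s : 'cV[R]_n), A *m s = a *: s /\ s != 0.
  exists a, ((enorm s)^-1 *: s); rewrite -scalemxAr As; split.
    by rewrite !scalerA mulrC.
  rewrite enormZ ger0_norm ?invr_ge0 ?enorm_ge0 // mulVf //.
  by rewrite enorm_eq0.
pose AC := map_mx (real_complex R) A.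
have [l /eigenvalueP [u uA un0]] := eigenvalue_closed AC n0.
pose x : 'cV[R]_n := \col_i complex.Re (u 0 i).
pose y : 'cV[R]_n := \col_i complex.Im (u 0 i).
pose a := complex.Re l; pose b := complex.Im l.
have entry i : \sum_j u 0 j * (real_complex R (A i j)) = l * u 0 i.
  move/rowP/(_ i): uA; rewrite !mxE => <-; apply: eq_bigr => j _.
  by rewrite !mxE -{1}symA mxE.
have Ax : A *m x = a *: x - b *: y.
  apply/colP => i; have /(congr1 (@complex.Re R)) := entry i.
  rewrite raddf_sum /= !mxE /a /b => h.
  transitivity (complex.Re (l * u 0 i)); last first.
    by case: (l) (u 0 i) => [? ?] [? ?] /=.
  rewrite -h; apply: eq_bigr => j _; rewrite !mxE.
  by case: (u 0 j) => [? ?] /=; ring.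
have Ay : A *m y = a *: y + b *: x.
  apply/colP => i; have /(congr1 (@complex.Im R)) := entry i.
  rewrite raddf_sum /= !mxE /a /b => h.
  transitivity (complex.Im (l * u 0 i)); last first.
    by case: (l) (u 0 i) => [? ?] [? ?] /=; ring.
  rewrite -h; apply: eq_bigr => j _; rewrite !mxE.
  by case: (u 0 j) => [? ?] /=; ring.
have nz : (x != 0) || (y != 0).
  rewrite -negb_and; apply: contra un0 => /andP[/eqP x0 /eqP y0].
  apply/eqP/rowP => i; rewrite mxE.
  move/colP/(_ i): x0; move/colP/(_ i): y0; rewrite !mxE.
  by case: (u 0 i) => [? ?] /= -> ->.
have b0 : b = 0.
  have h := dotv_mull A x y; rewrite symA Ax Ay !dotvP in h.
  have {h} /eqP : b * (dotv x x + dotv y y) = 0 by lra.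
  rewrite mulf_eq0 => /orP[/eqP //|].
  rewrite paddr_eq0 ?dotvv_ge0 // !dotvv_eq0 => /andP[/eqP x0 /eqP y0].
  by move: nz; rewrite x0 y0 eqxx.
case/orP: nz => nz.
  by exists a, x; split=> //; rewrite Ax b0 scale0r subr0.
by exists a, y; split=> //; rewrite Ay b0 scale0r addr0.
Qed.

(* The Householder reflection exchanging e_0 and s. *)
Lemma orthogonal_with_first_column n (s : 'cV[R]_(1 + n)) : enorm s = 1 ->
  exists2 Q : 'M[R]_(1 + n), Q^T *m Q = 1%:M & Q *m delta_mx 0 0 = s.
Proof.
move=> s1; pose e : 'cV[R]_(1 + n) := delta_mx 0 0.
have ee : dotv e e = 1.
  by rewrite /dotv /e trmx_delta mul_delta_mx mxE.
have ss : dotv s s = 1 by rewrite -enorm_sqr s1 expr1n.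
pose w := s - e.
have [w0|wn0] := eqVneq w 0.
  exists 1%:M; first by rewrite trmx1 mulmx1.
  by rewrite mul1mx; move/eqP: w0; rewrite subr_eq0 => /eqP.
have wwn0 : dotv w w != 0 by rewrite dotvv_eq0.
have wwE : w^T *m w = (dotv w w)%:M by rewrite [LHS]mx11_scalar.
pose c := 2 / dotv w w.
have symQ : (1%:M - c *: (w *m w^T))^T = 1%:M - c *: (w *m w^T).
  apply/matrixP => i j; rewrite !mxE eq_sym; congr (_ - _ * _).
  by apply: eq_bigr => l _; rewrite !mxE mulrC.
exists (1%:M - c *: (w *m w^T)).
  rewrite symQ mulmxBl mul1mx mulmxBr mulmx1 -scalemxAl -scalemxAr.
  rewrite mulmxA -(mulmxA w) wwE mul_mx_scalar -scalemxAl !scalerA.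
  have -> : c * (c * dotv w w) = c + c by rewrite /c; field.
  by rewrite scalerDl opprB addrK subrK.
rewrite mulmxBl mul1mx -scalemxAl -mulmxA -/e.
have -> : w^T *m e = (dotv w e)%:M by rewrite [LHS]mx11_scalar.
rewrite mul_mx_scalar scalerA.
(* Since s and e have equal length, |w|^2 = -2 w . e; the reflection therefore sends e to e + w =
   s. *)
have -> : c * dotv w e = - 1.
  have : dotv w w = - (2 * dotv w e).
    by rewrite /w !dotvP ee ss (dotvC e s); ring.
  rewrite /c => h; move: wwn0; rewrite h oppr_eq0 mulf_eq0 => /norP[_ ?].
  by field.
by rewrite scaleN1r opprK /w addrC subrK.
Qed.

(** Deflation: a reflection moves a unit eigenvector to e_0, so the first column of B = Q^T A Q is a
    multiple of e_0. Symmetry clears the first row as well, and the induction hypothesis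
    diagonalizes the remaining block. *)
Lemma symmetric_spectral n (A : 'M[R]_n) : A^T = A ->
  exists (P : 'M[R]_n) (d : 'rV[R]_n),
    P^T *m P = 1%:M /\ A *m P = P *m diag_mx d.
Proof.
elim: n A => [|n IH] A symA.
  by exists 1%:M, 0; split; apply/matrixP => -[].
have [a [s [As s1]]] := symmetric_unit_eigenvector (ltn0Sn n) symA.
rewrite -[n.+1]/(1 + n)%N in A symA s As s1 *.
have [Q QQ Qs] := orthogonal_with_first_column s1.
have QQ' : Q *m Q^T = 1%:M by apply: mulmx1C.
have [B defB] : exists B, B = Q^T *m A *m Q by exists (Q^T *m A *m Q).
have symB : B^T = B by rewrite defB !trmx_mul trmxK symA mulmxA.
have Be : B *m delta_mx 0 0 = a *: (delta_mx 0 0 : 'cV_(1 + n)).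
  by rewrite defB -!mulmxA Qs As -scalemxAr -Qs mulmxA QQ mul1mx.
have Bi i : B i 0 = a * (i == 0)%:R.
  move/colP/(_ i): Be; rewrite -colE !mxE => ->.
  by rewrite eqxx andbT.
have [P [d [PP BP]]] : exists (P : 'M[R]_n) (d : 'rV[R]_n),
    P^T *m P = 1%:M /\ drsubmx B *m P = P *m diag_mx d.
  by apply: IH; rewrite trmx_drsub symB.
have l0 : lshift n 0 = 0 :> 'I_(1 + n) by apply: val_inj.
have Bdl : dlsubmx B = 0.
  apply/matrixP => i j; rewrite !mxE ord1 l0 Bi.
  by rewrite (_ : (rshift 1 i == 0) = false) ?mulr0.
have Bur : ursubmx B = 0 by rewrite -[B]symB -trmx_dlsub Bdl trmx0.
have Bul : ulsubmx B = a%:M.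
  by rewrite [LHS]mx11_scalar; congr (_%:M); rewrite !mxE !l0 Bi mulr1.
have BE : B = block_mx a%:M 0 0 (drsubmx B).
  by rewrite -[LHS]submxK Bul Bur Bdl.
exists (Q *m block_mx 1%:M 0 0 P), (row_mx a%:M d); split.
  rewrite trmx_mul mulmxA -(mulmxA _ Q^T) QQ mulmx1 tr_block_mx mulmx_block.
  by rewrite !trmx0 trmx1 !mul0mx !mulmx0 !addr0 add0r mulmx1 PP scalar_mx_block.
have AQ : A *m Q = Q *m B by rewrite defB !mulmxA QQ' mul1mx.
rewrite mulmxA AQ -!mulmxA; congr (_ *m _); rewrite BE.
rewrite diag_mx_row !mulmx_block !mul0mx !mulmx0 !addr0 !add0r mulmx1 BP mul1mx.
by congr block_mx; apply/matrixP => i j; rewrite !mxE !ord1 eqxx !mulr1n.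
Qed.

Lemma orthogonal_col_dotv n (P : 'M[R]_n) i j : P^T *m P = 1%:M ->
  dotv (col i P) (col j P) = (i == j)%:R.
Proof.
move=> /matrixP/(_ i j); rewrite !mxE => <-; rewrite dotvE.
by apply: eq_bigr => l _; rewrite !mxE.
Qed.

Lemma orthogonal_col_enorm n (P : 'M[R]_n) i : P^T *m P = 1%:M ->
  enorm (col i P) = 1.
Proof.
move=> PP; apply: (@pexpIrn _ 2) => //; rewrite ?nnegrE ?enorm_ge0 //.
by rewrite enorm_sqr orthogonal_col_dotv // eqxx expr1n.
Qed.

Lemma orthogonal_parseval n (P : 'M[R]_n) (x y : 'cV[R]_n) :
  P^T *m P = 1%:M ->
  dotv x y = \sum_i dotv (col i P) x * dotv (col i P) y.
Proof.
move=> /mulmx1C PP.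
have -> : dotv x y = dotv (P^T *m x) (P^T *m y).
  by rewrite dotv_mull trmxK mulmxA PP mul1mx.
rewrite dotvE; apply: eq_bigr => i _.
have E z : (P^T *m z) i 0 = dotv (col i P) z.
  by rewrite dotvE !mxE; apply: eq_bigr => j _; rewrite !mxE.
by rewrite !E.
Qed.

Lemma diagonalized_col n (A P : 'M[R]_n) d i : A *m P = P *m diag_mx d ->
  A *m col i P = d 0 i *: col i P.
Proof.
move=> AP; rewrite {1}colE mulmxA AP -colE; apply/colP => j.
by rewrite mul_mx_diag !mxE mulrC.
Qed.

Lemma symmetric_eigenvalueP n (A : 'M[R]_n) a (s : 'cV[R]_n) : A^T = A ->
  A *m s = a *: s -> s != 0 -> eigenvalue A a.
Proof.
move=> symA As sn0; apply/eigenvalueP; exists s^T.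
  by rewrite -{1}symA -trmx_mul As linearZ.
by apply: contra sn0 => /eqP s0; rewrite -[s]trmxK s0 trmx0.
Qed.

(** If every eigenvalue were farther than r from t, each component of x in the eigenbasis would be
    scaled by more than r. The residual bound then forces all components to vanish, against x !=
    0. *)
Lemma eigenvalue_near_of_residual n (A : 'M[R]_n) (t r : R) (x : 'cV[R]_n) :
  A^T = A -> x != 0 -> enorm (A *m x - t *: x) <= r * enorm x ->
  exists2 l, eigenvalue A l & `|t - l| <= r.
Proof.
move=> symA xn0 res.
have [P [d [PP AP]]] := symmetric_spectral symA.
have [[i hi]|/forallNP H] := pselect (exists i, `|t - d 0 i| <= r).
  exists (d 0 i) => //; apply: (@symmetric_eigenvalueP _ _ _ (col i P)) => //.
    exact: diagonalized_col.
  by rewrite -enorm_eq0 orthogonal_col_enorm ?oner_eq0.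
exfalso.
have xp : 0 < enorm x by rewrite lt_neqAle eq_sym enorm_eq0 xn0 enorm_ge0.
have r0 : 0 <= r by rewrite -(pmulr_lge0 _ xp) (le_trans (enorm_ge0 _) res).
have coef i : dotv (col i P) (A *m x - t *: x) = (d 0 i - t) * dotv (col i P) x.
  rewrite dotvDr dotvNr dotvZr -{1}symA -dotv_mull (diagonalized_col _ AP) dotvZl.
  ring.
have lt i : r ^+ 2 < (d 0 i - t) ^+ 2.
  rewrite -[(d 0 i - t) ^+ 2]real_normK ?num_real // distrC ltr_sqr ?nnegrE //.
  by rewrite ltNge; apply/negP/H.
have res2 : dotv (A *m x - t *: x) (A *m x - t *: x) <= r ^+ 2 * dotv x x.
  by rewrite -!enorm_sqr -exprMn ler_sqr ?nnegrE ?mulr_ge0 ?enorm_ge0.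
rewrite !(orthogonal_parseval _ _ PP) mulr_sumr in res2.
have/eqP : \sum_i ((d 0 i - t) ^+ 2 - r ^+ 2) * dotv (col i P) x ^+ 2 = 0.
  apply/eqP; rewrite eq_le; apply/andP; split.
    rewrite -subr_le0 in res2; apply: le_trans res2.
    rewrite -sumrB; apply: ler_sum => i _; rewrite coef.
    by rewrite le_eqVlt; apply/orP; left; apply/eqP; ring.
  by apply: sumr_ge0 => i _; rewrite mulr_ge0 ?sqr_ge0 // subr_ge0 ltW.
rewrite psumr_eq0; last first.
  by move=> i _; rewrite mulr_ge0 ?sqr_ge0 // subr_ge0 ltW.
move=> /allP h0; move: xn0; rewrite -dotvv_eq0 (orthogonal_parseval _ _ PP).
rewrite big1 ?eqxx // => i _; have := h0 i (mem_index_enum _).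
by rewrite /= mulf_eq0 subr_eq0 gt_eqF // sqrf_eq0 => /eqP ->; rewrite mul0r.
Qed.

End Spectral.

(** * Perturbed three-term recurrences *)

Section ThreeTermRecurrence.
Variables (R : realType) (n : nat) (A : 'M[R]_n) (vs fs : nat -> 'cV[R]_n).
Variables (alpha beta : nat -> R) (k : nat).
Implicit Types (s y : nat -> R) (m p q : nat).

(** Row p of the tridiagonal matrix acting on a sequence. Working with sequences lets the same
    coefficients serve the matrices of all orders m; only row m sees [s m.+1], and [s 0] is
    multiplied by [beta 0]. *)
Definition tridiag_act s p : R :=
  beta p.-1 * s p.-1 + alpha p * s p + beta p * s p.+1.

(* One-based partial combination: the sum of [s p *: us p] over 1 <= p < q. *)
Definition lincomb s (us : nat -> 'cV[R]_n) q : 'cV[R]_n :=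
  \sum_(1 <= p < q) s p *: us p.

(** The discrete Wronskian of the coefficients [s] and the vectors [vs]: the boundary term left when
    the recurrence is summed against [s]. *)
Definition flux s q : 'cV[R]_n :=
  beta q *: (s q *: vs q.+1 - s q.+1 *: vs q).

Lemma lincomb1 s us : lincomb s us 1 = 0.
Proof. by rewrite /lincomb big_geq. Qed.

Lemma lincombS s us q : lincomb s us q.+2 = lincomb s us q.+1 + s q.+1 *: us q.+1.
Proof. by rewrite /lincomb big_nat_recr. Qed.

Lemma lincomb_enorm_le s us (m q : nat) (b : R) : (q <= m)%N -> 0 <= b ->
  (forall p, `|s p| <= 1) -> (forall p, (1 <= p <= m)%N -> enorm (us p) <= b) ->
  enorm (lincomb s us q.+1) <= m%:R * b.
Proof.
move=> qm b0 s1 usb; apply: (@le_trans _ _ (q%:R * b)); last first.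
  by rewrite ler_wpM2r // ler_nat.
elim: q qm => [|q IH] qm; first by rewrite lincomb1 enorm0 mul0r.
rewrite lincombS; apply: le_trans (enormD _ _) _.
rewrite -natr1 mulrDl mul1r; apply: lerD; first by apply: IH; exact: ltnW.
rewrite enormZ -[leRHS]mul1r; apply: ler_pM; rewrite ?enorm_ge0 //.
by apply: usb; rewrite qm.
Qed.

Hypothesis beta0 : beta 0%N = 0.

Lemma flux0 s : flux s 0 = 0.
Proof. by rewrite /flux beta0 scale0r. Qed.

(** Discrete Green identity: the tridiagonal action is symmetric, so the sum telescopes to its
    boundary term at m, the one at 0 being killed by [beta0]. *)
Lemma wronskian_sum s y m :
  \sum_(1 <= p < m.+1) (s p * tridiag_act y p - y p * tridiag_act s p) =
  beta m * (s m * y m.+1 - y m * s m.+1).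
Proof.
elim: m => [|m IH]; first by rewrite big_geq // beta0 mul0r.
by rewrite big_nat_recr //= IH /tridiag_act /=; ring.
Qed.

(** The first of the two identities behind the induction. Here [s] is an eigenvector of order m,
    while [y] comes from a larger order and need not vanish at m + 1. *)
Lemma wronskian_eigen s y m mu nu :
  (forall p, (1 <= p <= m)%N -> tridiag_act s p = mu * s p) ->
  (forall p, (1 <= p <= m)%N -> tridiag_act y p = nu * y p) ->
  s m.+1 = 0 ->
  (nu - mu) * \sum_(1 <= p < m.+1) s p * y p = beta m * s m * y m.+1.
Proof.
move=> hs hy s0; have := wronskian_sum s y m; rewrite s0 mulr0 subr0 mulrA => <-.
rewrite mulr_sumr; apply: eq_big_nat => p pm; rewrite hs // hy //; ring.
Qed.

Lemma dotv_lincomb_self s m :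
  dotv (lincomb s vs m.+1) (lincomb s vs m.+1) =
  \sum_(1 <= q < m.+1) s q ^+ 2 * dotv (vs q) (vs q) +
  2 * \sum_(1 <= q < m.+1) s q * dotv (vs q) (lincomb s vs q).
Proof.
elim: m => [|m IH]; first by rewrite lincomb1 dotv0l !big_geq // mulr0 addr0.
rewrite lincombS !(big_nat_recr m.+1) //= !dotvP IH (dotvC (lincomb s vs m.+1)); ring.
Qed.

Lemma flux_summation_by_parts s m :
  \sum_(1 <= q < m.+1) dotv (flux s q - flux s q.-1) (lincomb s vs q) =
  dotv (flux s m) (lincomb s vs m.+1) -
  \sum_(1 <= q < m.+1) s q * dotv (flux s q) (vs q).
Proof.
elim: m => [|m IH]; first by rewrite !big_geq // lincomb1 dotv0r subr0.
rewrite !(big_nat_recr m.+1) //= IH lincombS !dotvP; ring.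
Qed.

Hypothesis recurrence : forall p, (1 <= p <= k)%N ->
  A *m vs p = beta p.-1 *: vs p.-1 + alpha p *: vs p + beta p *: vs p.+1 + fs p.

(** Moves the recurrence from the vectors onto the coefficients; the discrepancy is a difference of
    fluxes, which telescopes in [mulmx_lincomb]. *)
Lemma recurrence_flux s p : (1 <= p <= k)%N ->
  s p *: (A *m vs p) =
  tridiag_act s p *: vs p + (flux s p - flux s p.-1) + s p *: fs p.
Proof.
case: p => [//|p] pk; rewrite recurrence // /flux /tridiag_act /=.
by apply/colP => i; rewrite !mxE; ring.
Qed.

Lemma mulmx_lincomb s m : (m <= k)%N ->
  A *m lincomb s vs m.+1 =
  lincomb (tridiag_act s) vs m.+1 + flux s m + lincomb s fs m.+1.
Proof.
elim: m => [|m IH] mk; first by rewrite !lincomb1 mulmx0 flux0 !addr0.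
rewrite !lincombS mulmxDr -scalemxAr recurrence_flux //= IH ?(ltnW mk) //.
by apply/colP => i; rewrite !mxE; ring.
Qed.

Lemma lincomb_eigen s us m mu :
  (forall p, (1 <= p <= m)%N -> tridiag_act s p = mu * s p) ->
  lincomb (tridiag_act s) us m.+1 = mu *: lincomb s us m.+1.
Proof.
move=> hs; rewrite /lincomb scaler_sumr; apply: eq_big_nat => p pm.
by rewrite hs // scalerA.
Qed.

(** * Symmetry of A and loss of orthogonality *)

Hypothesis symA : A^T = A.

(* Computing the sum of s_q v_q . A X_q, where X_q = sum_(p < q) s_p v_p, from
   either side of the symmetric A. *)
Lemma next_vector_dotv_lincomb s m mu : (m <= k)%N ->
  (forall p, (1 <= p <= m)%N -> tridiag_act s p = mu * s p) ->
  s m.+1 = 0 ->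
  beta m * s m * dotv (vs m.+1) (lincomb s vs m.+1) =
  \sum_(1 <= q < m.+1)
    (dotv (s q *: vs q + s q.+1 *: vs q.+1) (flux s q) +
     s q * dotv (vs q) (lincomb s fs q) - s q * dotv (fs q) (lincomb s vs q)).
Proof.
move=> mk hs sm.
(* In s_q v_q . A X_q the eigenvalue contributes mu s_q v_q . X_q from either side and cancels,
   leaving only fluxes and defects. *)
have hq q : (1 <= q < m.+1)%N ->
    dotv (flux s q - flux s q.-1) (lincomb s vs q) =
    s q * dotv (vs q) (flux s q.-1) +
    (s q * dotv (vs q) (lincomb s fs q) - s q * dotv (fs q) (lincomb s vs q)).
  case: q => [//|q] /= qm.
  have qk : (1 <= q.+1 <= k)%N by rewrite /= (leq_trans _ mk).
  have := dotv_mull A (s q.+1 *: vs q.+1) (lincomb s vs q.+1).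
  rewrite symA -scalemxAr recurrence_flux // mulmx_lincomb; last by case/andP: qk => _ /ltnW.
  rewrite (lincomb_eigen _ (mu := mu)); last first.
    by move=> p /andP[p1 pq]; apply: hs; rewrite p1 (leq_trans pq) // ltnW.
  rewrite hs //= !dotvP => h; lra.
(* An index shift by one; the end terms vanish because [s m.+1] and [flux s 0] are zero. *)
have shift : \sum_(1 <= q < m.+1) s q * dotv (vs q) (flux s q.-1) =
             \sum_(1 <= q < m.+1) s q.+1 * dotv (vs q.+1) (flux s q).
  apply/eqP; rewrite eq_sym -subr_eq0 -sumrB telescope_sumr //= sm flux0.
  by rewrite mul0r dotv0r mulr0 subr0.
have hL : beta m * s m * dotv (vs m.+1) (lincomb s vs m.+1) =
          dotv (flux s m) (lincomb s vs m.+1).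
  by rewrite /flux sm scale0r subr0 !dotvP mulrA.
rewrite hL; have := flux_summation_by_parts s m.
rewrite (eq_big_nat _ _ hq) big_split /= shift => /esym/eqP.
rewrite subr_eq => /eqP ->; rewrite -!big_split /=; apply: eq_bigr => q _.
rewrite (dotvC (flux s q)) dotvDl !dotvZl; ring.
Qed.

Variables phi psi : R.
Hypothesis phi0 : 0 <= phi.
Hypothesis fs_le : forall p, (1 <= p <= k)%N -> enorm (fs p) <= phi.
Hypothesis vs_norm : forall p, (1 <= p <= k)%N ->
  `|dotv (vs p) (vs p) - 1| <= 20^-1.
Hypothesis local_orthogonality : forall p, (1 <= p < k)%N ->
  `|beta p * dotv (vs p) (vs p.+1)| <= psi.
Hypothesis norm_variation : forall p, (1 <= p < k)%N ->
  `|beta p * (dotv (vs p.+1) (vs p.+1) - dotv (vs p) (vs p))| <= psi.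

Lemma vs_le2 p : (1 <= p <= k)%N -> enorm (vs p) <= 2.
Proof.
move=> /vs_norm; rewrite -enorm_sqr ler_distl => /andP[_ h].
rewrite -ler_sqr ?nnegrE ?enorm_ge0 //; lra.
Qed.

(** Each summand of the exact identity is small: its flux term pairs only neighbouring vectors and
    is bounded through [psi], and its defect terms pair [phi] with sums of at most m vectors of norm
    at most 2. *)
Lemma next_vector_dotv_lincomb_le s m mu : (m < k)%N ->
  (forall p, (1 <= p <= m)%N -> tridiag_act s p = mu * s p) ->
  s m.+1 = 0 -> (forall p, `|s p| <= 1) ->
  `|beta m * s m * dotv (vs m.+1) (lincomb s vs m.+1)| <=
  m%:R * (2 * psi + 4 * m%:R * phi).
Proof.
move=> mk hs sm s1; rewrite (next_vector_dotv_lincomb (mu := mu)) // ?(ltnW mk) //.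
apply: le_trans (ler_norm_sum _ _ _) _.
rewrite [leRHS](_ : _ = \sum_(1 <= q < m.+1) (2 * psi + 4 * m%:R * phi)); last first.
  by rewrite sumr_const_nat subn1 /= mulr_natl.
apply: ler_sum_nat => q /andP[q1]; rewrite ltnS => qm.
have qk : (1 <= q < k)%N by rewrite q1 (leq_ltn_trans qm).
have qk' : (1 <= q <= k)%N by rewrite q1 ltnW //; case/andP: qk.
have h1 : `|dotv (s q *: vs q + s q.+1 *: vs q.+1) (flux s q)| <= 2 * psi.
  have -> : dotv (s q *: vs q + s q.+1 *: vs q.+1) (flux s q) =
      (s q ^+ 2 - s q.+1 ^+ 2) * (beta q * dotv (vs q) (vs q.+1)) +
      s q * s q.+1 *
        (beta q * (dotv (vs q.+1) (vs q.+1) - dotv (vs q) (vs q))).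
    by rewrite /flux !dotvP (dotvC (vs q.+1) (vs q)); ring.
  rewrite (_ : 2 * psi = 1 * psi + 1 * psi); last by ring.
  apply: le_trans (ler_normD _ _) _; rewrite 2!(normrM _ (beta q * _)).
  have sq r : 0 <= s r ^+ 2 <= 1.
    by rewrite sqr_ge0 /= -real_normK ?num_real // exprn_ile1.
  apply: lerD; apply: ler_pM => //; rewrite ?local_orthogonality ?norm_variation //.
    have := sq q; have := sq q.+1; rewrite ler_norml => /andP[? ?] /andP[? ?]; lra.
  by rewrite normrM mulr_ile1.
have h2 : `|s q * dotv (vs q) (lincomb s fs q)| <= 2 * (m%:R * phi).
  rewrite normrM -[leRHS]mul1r; apply: ler_pM => //.
  apply: le_trans (cauchy_schwarz_dotv _ _) _.
  apply: ler_pM; rewrite ?enorm_ge0 ?vs_le2 //.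
  case: q q1 qm {qk qk' h1} => [//|q] _ qm.
  apply: lincomb_enorm_le; rewrite ?(ltnW qm) // => p /andP[p1 pm].
  by apply: fs_le; rewrite p1 (leq_trans pm) // ltnW.
have h3 : `|s q * dotv (fs q) (lincomb s vs q)| <= phi * (m%:R * 2).
  rewrite normrM -[leRHS]mul1r; apply: ler_pM => //.
  apply: le_trans (cauchy_schwarz_dotv _ _) _.
  apply: ler_pM; rewrite ?enorm_ge0 ?fs_le //.
  case: q q1 qm {qk qk' h1 h2} => [//|q] _ qm.
  apply: lincomb_enorm_le; rewrite ?(ltnW qm) // => p /andP[p1 pm].
  by apply: vs_le2; rewrite p1 (leq_trans pm) // ltnW.
apply: le_trans (ler_normB _ _) _.
have := ler_normD (dotv (s q *: vs q + s q.+1 *: vs q.+1) (flux s q))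
  (s q * dotv (vs q) (lincomb s fs q)).
lra.
Qed.

End ThreeTermRecurrence.

(* One-based coefficients of a vector, extended by zero. *)
Definition vcoef (R : realType) m (x : 'cV[R]_m) (p : nat) : R :=
  if p is p'.+1 then oapp (fun i => x i 0) 0 (insub p' : option 'I_m) else 0.

(** * The tridiagonal matrix as an action on coefficient sequences *)

Section OneBasedCoefficients.
Variables (R : realType) (m : nat).
Implicit Types (x y : 'cV[R]_m).

Lemma vcoef_ord x (i : 'I_m) : vcoef x i.+1 = x i 0.
Proof. by rewrite /vcoef valK. Qed.

Lemma vcoef_gt x p : (m < p)%N -> vcoef x p = 0.
Proof. by case: p => [//|p] mp; rewrite /= insubF // ltnNge -ltnS mp. Qed.

Lemma vcoef_le_enorm x p : `|vcoef x p| <= enorm x.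
Proof.
case: p => [|p] /=; first by rewrite normr0 enorm_ge0.
case: insubP => [i _ _ |_] /=; last by rewrite normr0 enorm_ge0.
exact: normr_coef_le_enorm.
Qed.

Lemma big_nat1_ord (V : nmodType) (F : nat -> V) :
  \sum_(1 <= p < m.+1) F p = \sum_(i < m) F i.+1.
Proof. by rewrite big_add1 big_mkord. Qed.

Lemma vcoef_sum_delta x (p : nat) : \sum_(j < m) (p == j :> nat)%:R * x j 0 = vcoef x p.+1.
Proof.
rewrite /vcoef; case: insubP => [i _ <-|pm] /=.
  rewrite (bigD1 i) //= eqxx mul1r big1 ?addr0 // => j.
  by rewrite eq_sym -val_eqE /= => /negbTE ->; rewrite mul0r.
rewrite big1 // => j _; case: eqP => [pj|_]; last by rewrite mul0r.
by move: pm; rewrite pj ltn_ord.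
Qed.

Lemma tridiag_mulmx (alpha beta : nat -> R) x (i : 'I_m) :
  (tridiag m alpha beta *m x) i 0 = tridiag_act alpha beta (vcoef x) i.+1.
Proof.
rewrite mxE.
have -> : \sum_j tridiag m alpha beta i j * x j 0 =
    \sum_(j < m) (alpha i.+1 * ((i == j :> nat)%:R * x j 0) +
      beta i.+1 * ((i.+1 == j :> nat)%:R * x j 0) +
      beta i * ((i == j.+1 :> nat)%:R * x j 0)).
  apply: eq_bigr => j _; rewrite mxE (eq_sym j.+1).
  case: (eqVneq (i : nat) j) => [->|ij].
    by rewrite gtn_eqF // ltn_eqF //=; ring.
  case: (eqVneq i.+1 (j : nat)) => [<-|_].
    by rewrite ltn_eqF //=; ring.
  by case: (eqVneq (i : nat) j.+1) => [->|_] /=; ring.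
rewrite !big_split /= -!mulr_sumr !vcoef_sum_delta.
(* The first row has no left neighbour; this agrees with the default value 0 of [vcoef x 0]. *)
have -> : \sum_(j < m) (i == j.+1 :> nat)%:R * x j 0 = vcoef x i.
  case: (i : nat) => [|p]; last by rewrite -vcoef_sum_delta.
  by rewrite big1 // => j _; rewrite mul0r.
by rewrite /tridiag_act succnK; ring.
Qed.

Lemma tridiag_eigen_act (alpha beta : nat -> R) x mu :
  tridiag m alpha beta *m x = mu *: x ->
  forall p, (1 <= p <= m)%N ->
    tridiag_act alpha beta (vcoef x) p = mu * vcoef x p.
Proof.
move=> /colP h [//|p] pm; have := h (Ordinal pm).
by rewrite tridiag_mulmx mxE -vcoef_ord.
Qed.

Lemma dotv_coef1 x y :
  dotv x y = \sum_(1 <= p < m.+1) vcoef x p * vcoef y p.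
Proof.
rewrite dotvE big_nat1_ord; apply: eq_bigr => i _.
by rewrite !vcoef_ord.
Qed.

End OneBasedCoefficients.

Lemma tr_tridiag (R : realType) m (alpha beta : nat -> R) :
  (tridiag m alpha beta)^T = tridiag m alpha beta.
Proof.
apply/matrixP => i j; rewrite !mxE eq_sym.
case: eqVneq => [->//|_].
case: (eqVneq j.+1 (i : nat)) => [<-|//].
by rewrite gtn_eqF // ltnS.
Qed.

Lemma exists_large_summand (R : realType) (m : nat) (F : nat -> R) (b : R) :
  (0 < m)%N -> b < `|\sum_(1 <= q < m.+1) F q| ->
  exists2 q, (1 <= q <= m)%N & b < m%:R * `|F q|.
Proof.
move=> m0 H; apply: contrapT => /forall2NP N.
move: H; rewrite ltNge => /negP; apply.
apply: le_trans (ler_norm_sum _ _ _) _.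
have mp : 0 < m%:R :> R by rewrite ltr0n.
rewrite [leRHS](_ : b = \sum_(1 <= q < m.+1) (b / m%:R)); last first.
  by rewrite sumr_const_nat subn1 /= -[RHS]mulr_natr divfK ?gt_eqF.
apply: ler_sum_nat => q; rewrite ltnS => qm.
case: (N q) => [//|/negP]; rewrite -leNgt => h.
by rewrite ler_pdivlMr // mulrC.
Qed.

(** * Paige's induction *)

Section Paige.
Variables (R : realType) (n : nat) (A : 'M[R]_n) (vs fs : nat -> 'cV[R]_n).
Variables (alpha beta : nat -> R) (k : nat) (phi psi : R).
Hypothesis symA : A^T = A.
Hypothesis beta0 : beta 0%N = 0.
Hypothesis beta_ge0 : forall p, (p <= k)%N -> 0 <= beta p.
Hypothesis recurrence : forall p, (1 <= p <= k)%N ->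
  A *m vs p = beta p.-1 *: vs p.-1 + alpha p *: vs p + beta p *: vs p.+1 + fs p.
Hypothesis phi0 : 0 <= phi.
Hypothesis psi0 : 0 <= psi.
Hypothesis fs_le : forall p, (1 <= p <= k)%N -> enorm (fs p) <= phi.
Hypothesis vs_norm : forall p, (1 <= p <= k)%N ->
  `|dotv (vs p) (vs p) - 1| <= 20^-1.
Hypothesis last_residual : enorm (beta k *: vs k.+1) <= 2 * beta k.
Hypothesis local_orthogonality : forall p, (1 <= p < k)%N ->
  `|beta p * dotv (vs p) (vs p.+1)| <= psi.
Hypothesis norm_variation : forall p, (1 <= p < k)%N ->
  `|beta p * (dotv (vs p.+1) (vs p.+1) - dotv (vs p) (vs p))| <= psi.

Let T m := tridiag m alpha beta.
(** The bound of [next_vector_dotv_lincomb_le] with m enlarged to k, so that one constant serves all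
    orders in the induction. *)
Let h : R := k%:R * (2 * psi + 4 * k%:R * phi).

Let h_ge0 : 0 <= h.
Proof. by rewrite mulr_ge0 // addr_ge0 // ?mulr_ge0. Qed.

Let phi_le_h : (0 < k)%N -> phi <= h.
Proof.
move=> k0; have k1 : 1 <= k%:R :> R by rewrite ler1n.
rewrite /h; move: phi0 psi0; move: (k%:R : R) k1 => K K1 f0 p0.
have k2 : 1 <= K * K by rewrite -[1]mulr1 ler_pM.
have p1 : 0 <= K * psi by rewrite mulr_ge0 // (le_trans _ K1).
have p2 : 0 <= (K * K - 1) * phi by rewrite mulr_ge0 // subr_ge0.
lra.
Qed.

Lemma residual_le m (s : 'cV[R]_m) mu : (1 <= m <= k)%N -> T m *m s = mu *: s ->
  enorm s = 1 ->
  enorm (A *m lincomb (vcoef s) vs m.+1 - mu *: lincomb (vcoef s) vs m.+1) <=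
  2 * (beta m * `|vcoef s m|) + m%:R * phi.
Proof.
move=> /andP[m1 mk] Ts s1; have act := tridiag_eigen_act Ts.
rewrite (mulmx_lincomb beta0 recurrence) // (lincomb_eigen _ act) addrAC addrC.
rewrite [_ + flux _ _ _ _]addrC addrK addrC.
apply: le_trans (enormD _ _) _; apply: lerD.
  rewrite /flux (vcoef_gt _ (ltnSn m)) scale0r subr0 scalerA mulrC -scalerA enormZ.
  rewrite mulrA mulrC ler_wpM2r //.
  (* At m = k only the product [beta k *: vs k.+1] is controlled, since [vs k.+1] is arbitrary after
     termination. *)
  have [->//|nmk] := eqVneq m k; have mltk : (m < k)%N by rewrite ltn_neqAle nmk.
  rewrite enormZ (ger0_norm (beta_ge0 mk)) mulrC ler_wpM2r ?beta_ge0 //.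
  by apply: (vs_le2 vs_norm); rewrite mltk.
apply: (lincomb_enorm_le (leqnn m)) => // p; first by rewrite -s1 vcoef_le_enorm.
by move=> /andP[p1 pm]; apply: fs_le; rewrite p1 (leq_trans pm).
Qed.

(* If the Ritz vector is short, the cross terms of its squared norm are large;
   expanding the largest one over the eigenvectors of [T j] exhibits an
   eigenpair of [T j] whose eigenvalue and last coefficient satisfy
   (theta - mu) (c . y') = beta_j c_j y_(j+1). *)
Lemma short_ritz_vector m (s : 'cV[R]_m) mu : (1 <= m <= k)%N ->
  T m *m s = mu *: s -> enorm s = 1 ->
  enorm (lincomb (vcoef s) vs m.+1) < 2^-1 ->
  exists j (c : 'cV[R]_j) nu,
    [/\ (1 <= j < m)%N, T j *m c = nu *: c, enorm c = 1,
        `|mu - nu| <= 4 * k%:R ^+ 2 * h &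
        beta j * `|vcoef c j| <= 4 * k%:R ^+ 2 * h].
Proof.
move=> /andP[m1 mk] Ts s1 short; have act := tridiag_eigen_act Ts.
have s_le1 p : `|vcoef s p| <= 1 by rewrite -s1 vcoef_le_enorm.
have sum_s : \sum_(1 <= p < m.+1) vcoef s p ^+ 2 = 1.
  have := dotv_coef1 s s; rewrite -enorm_sqr s1 expr1n => ->.
  by apply: eq_bigr => p _; rewrite expr2.
(* The diagonal part is at least 19/20 and the whole square is below 1/4, so twice the cross sum is
   below -7/10. *)
have cross : 4^-1 < `|\sum_(1 <= q < m.+1)
    vcoef s q * dotv (vs q) (lincomb (vcoef s) vs q)|.
  have diag : 19 / 20 <= \sum_(1 <= q < m.+1)
      vcoef s q ^+ 2 * dotv (vs q) (vs q).
    have := mulr1 (19 / 20 : R); rewrite -[X in _ * X = _]sum_s => <-.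
    rewrite mulr_sumr; apply: ler_sum_nat => q.
    rewrite ltnS => /andP[q1 qm]; rewrite mulrC ler_wpM2l ?sqr_ge0 //.
    have := vs_norm (p := q); rewrite q1 (leq_trans qm) // => /(_ isT).
    rewrite ler_distl => /andP[? _]; lra.
  have := dotv_lincomb_self vs (vcoef s) m.
  have : dotv (lincomb (vcoef s) vs m.+1) (lincomb (vcoef s) vs m.+1) < 4^-1.
    rewrite -enorm_sqr [ltRHS](_ : _ = 2^-1 ^+ 2); last by field.
    by rewrite ltr_sqr ?nnegrE ?enorm_ge0.
  set D := \sum_(1 <= q < m.+1) vcoef s q ^+ 2 * _ in diag *.
  set C := \sum_(1 <= q < m.+1) vcoef s q * _.
  move=> lt e; rewrite -normrN; apply: lt_le_trans (ler_norm _); lra.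
have [[//|j] /andP[_ jm]] := exists_large_summand m1 cross.
(* The summand q = 1 pairs v_1 with an empty sum, so it cannot be the large one. *)
have [->|j0] := posnP j.
  by rewrite lincomb1 dotv0r mulr0 normr0 mulr0; lra.
have jk : (j < k)%N by exact: leq_trans mk.
set w := vcoef s j.+1 => large.
pose y : 'cV[R]_j := \col_i vcoef s i.+1.
pose r : 'cV[R]_j := \col_i dotv (vs j.+1) (vs i.+1).
have col_sum (x : 'cV[R]_j) (F : nat -> R) :
    dotv x (\col_i F i.+1) = \sum_(1 <= p < j.+1) vcoef x p * F p.
  by rewrite dotvE big_nat1_ord; apply: eq_bigr => i _; rewrite mxE vcoef_ord.
have dotr (x : nat -> R) : dotv (vs j.+1) (lincomb x vs j.+1) =
    \sum_(1 <= p < j.+1) x p * dotv (vs j.+1) (vs p).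
  rewrite /lincomb dotvC; elim/big_rec2: _ => [|p u1 u2 _ <-]; first by rewrite dotv0l.
  by rewrite !dotvP (dotvC (vs p)).
have [P [d [PP TP]]] := symmetric_spectral (tr_tridiag j alpha beta).
have expand : dotv (vs j.+1) (lincomb (vcoef s) vs j.+1) =
    \sum_(i < j) dotv (col i P) y * dotv (col i P) r.
  rewrite dotr -orthogonal_parseval // dotvE big_nat1_ord.
  by apply: eq_bigr => i _; rewrite !mxE.
(* Choosing first q and then i costs the factors m and j, both at most k, hence k^2. *)
have [i large_i] : exists i : 'I_j,
    4^-1 < k%:R ^+ 2 * `|w * (dotv (col i P) y * dotv (col i P) r)|.
  pose F q := if insub q.-1 is Some i then
     dotv (col (i : 'I_j) P) y * dotv (col i P) r else 0.
  have eF : \sum_(1 <= q < j.+1) m%:R * (w * F q) =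
      m%:R * (w * dotv (vs j.+1) (lincomb (vcoef s) vs j.+1)).
    rewrite -!mulr_sumr expand big_nat1_ord; congr (_ * (_ * _)).
    by apply: eq_bigr => i _; rewrite /F /= valK.
  have := @exists_large_summand R j (fun q => m%:R * (w * F q)) 4^-1 j0.
  rewrite eF normrM ger0_norm // => /(_ large)[[//|q] /andP[_ qj]].
  rewrite {1}/F /= insubT => big; exists (Ordinal qj).
  apply: lt_le_trans big _; rewrite normrM ger0_norm // [leLHS]mulrA.
  rewrite ler_wpM2r // expr2 ler_pM // ler_nat //; exact: ltnW.
pose c := col i P; pose nu := d 0 i.
have c1 : enorm c = 1 by exact: orthogonal_col_enorm.
have Tc : T j *m c = nu *: c by exact: diagonalized_col.
have c_le1 p : `|vcoef c p| <= 1 by rewrite -c1 vcoef_le_enorm.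
pose a := dotv c y; pose b := dotv c r.
have W : (mu - nu) * a = beta j * vcoef c j * w.
  rewrite /a /y (col_sum c (vcoef s)).
  apply: (wronskian_eigen (alpha := alpha) beta0) => //.
  - exact: (tridiag_eigen_act Tc).
  - by move=> p /andP[p1 pj]; apply: act; rewrite p1 (leq_trans pj) // ltnW.
  - exact: vcoef_gt.
have Hb : `|beta j * vcoef c j * b| <= h.
  rewrite /b /r (col_sum c (fun p => dotv (vs j.+1) (vs p))) -dotr.
  apply: le_trans (next_vector_dotv_lincomb_le beta0 recurrence symA phi0
    fs_le vs_norm local_orthogonality norm_variation jk _ _ c_le1) _.
  - exact: (tridiag_eigen_act Tc).
  - exact: vcoef_gt.
  have jk' : j%:R <= k%:R :> R by rewrite ler_nat ltnW.
  rewrite /h; apply: ler_pM => //; first by rewrite addr_ge0 // ?mulr_ge0.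
  by rewrite lerD2l ler_wpM2r // ler_wpM2l.
have a_le1 : `|a| <= 1.
  apply: le_trans (cauchy_schwarz_dotv _ _) _; rewrite c1 mul1r.
  rewrite -(ler_sqr (x := enorm y)) ?nnegrE ?enorm_ge0 // expr1n enorm_sqr.
  rewrite dotvE -sum_s (big_cat_nat (n := j.+1)) //=; last by rewrite ltnS ltnW.
  rewrite big_nat1_ord -[leLHS]addr0; apply: lerD; last first.
    by apply: sumr_ge0 => p _; rewrite sqr_ge0.
  by apply: ler_sum => l _; rewrite mxE expr2.
(* The lower bound on |w a b| is multiplied by |mu - nu|; by [W] the product equals |w|^2 |beta_j
   c_j b|, which [Hb] controls. Keeping |w|^2 leaves a factor |w| to cancel in the bound on beta_j
   |c_j|. *)
have gap : `|mu - nu| <= 4 * k%:R ^+ 2 * h * `|w| ^+ 2.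
  have e : `|mu - nu| * `|w * (a * b)| = `|w| ^+ 2 * `|beta j * vcoef c j * b|.
    by rewrite -normrX -!normrM; congr `|_|; rewrite [LHS](_ : _ = w * ((mu - nu) * a) * b); [rewrite W; ring | ring].
  rewrite -/a -/b in large_i.
  have k2 : 0 <= k%:R ^+ 2 :> R by rewrite sqr_ge0.
  have := ler_wpM2l (normr_ge0 (mu - nu)) (ltW large_i).
  rewrite mulrCA e => lower.
  have := ler_wpM2l (mulr_ge0 k2 (sqr_ge0 `|w|)) Hb; lra.
have K0 : 0 <= 4 * k%:R ^+ 2 * h by rewrite mulr_ge0 // mulr_ge0 // exprn_ge0.
exists j, c, nu; split => //; first by rewrite j0.
  apply: le_trans gap _; rewrite -[leRHS]mulr1 ler_wpM2l //.
  by apply: exprn_ile1 => //; exact: s_le1.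
have w0 : 0 < `|w|.
  rewrite normr_gt0; apply: contraTneq large_i => ->.
  by rewrite mul0r normr0 mulr0 -leNgt invr_ge0.
rewrite -(ler_pM2r w0) -[beta j]ger0_norm ?(beta_ge0 (ltnW jk)) // -!normrM -W normrM.
apply: (@le_trans _ _ `|mu - nu|); first by rewrite ler_piMr.
apply: le_trans gap _; rewrite (expr2 `|w|) mulrA ler_piMr // ?s_le1 //.
by rewrite mulr_ge0.
Qed.

(** Passing from order m to j < m costs the gap 4 k^2 h plus four times the bound 4 k^2 h on the
    last coefficient. This total 20 k^2 h is paid by the drop of the factor m to j, so errors add up
    instead of compounding. *)
Lemma ritz_value_near_spectrum m (s : 'cV[R]_m) mu : (1 <= m <= k)%N ->
  T m *m s = mu *: s -> enorm s = 1 ->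
  exists2 l, eigenvalue A l &
    `|mu - l| <= 4 * (beta m * `|vcoef s m|) + m%:R * (20 * k%:R ^+ 2 * h).
Proof.
elim/ltn_ind: m s mu => m IH s mu mk Ts s1.
have mk' : (m <= k)%N by case/andP: mk.
have k0 : (0 < k)%N by case/andP: mk => /leq_trans; apply.
have k2 : 1 <= k%:R ^+ 2 :> R by rewrite exprn_ege1 // ler1n.
have hk : h <= k%:R ^+ 2 * h by rewrite ler_peMl.
have [short|long] := ltP (enorm (lincomb (vcoef s) vs m.+1)) 2^-1.
  have [j [c [nu [/andP[j1 jm] Tc c1 gap last]]]] := short_ritz_vector mk Ts s1 short.
  have jk : (1 <= j <= k)%N.
    by rewrite j1 (leq_trans (ltnW jm)) //; case/andP: mk.
  have [l Al hl] := IH j jm c nu jk Tc c1.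
  exists l => //; apply: le_trans (ler_distD nu _ _) _.
  have jm' : j%:R + 1 <= m%:R :> R by rewrite natr1 ler_nat.
  have := ler_wpM2r (mulr_ge0 (ler0n R 20) (le_trans h_ge0 hk)) jm'.
  have := mulr_ge0 (beta_ge0 mk') (normr_ge0 (vcoef s m)).
  lra.
have xn0 : lincomb (vcoef s) vs m.+1 != 0.
  rewrite -enorm_eq0 gt_eqF //; apply: lt_le_trans long; lra.
apply: (eigenvalue_near_of_residual symA xn0).
apply: le_trans (residual_le mk Ts s1) _.
have mphi : m%:R * phi <= m%:R * (k%:R ^+ 2 * h).
  by rewrite ler_wpM2l // (le_trans (phi_le_h k0)).
have b0 := mulr_ge0 (beta_ge0 mk') (normr_ge0 (vcoef s m)).
have m0 := mulr_ge0 (ler0n R m) (le_trans h_ge0 hk).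
(* A vector of length at least 1/2 at most doubles the residual relative to its norm, which turns
   the factor 2 of [residual_le] into 4. *)
set r := 4 * _ + _; have r0 : 0 <= r by rewrite /r; lra.
have := ler_wpM2l r0 long; rewrite {1}/r; lra.
Qed.

End Paige.

(** * Rounding error bounds *)

Section FinitePrecisionRun.
Variables (R : realType) (n k : nat) (eps : R) (A : 'M[R]_n) (v : 'cV[R]_n).
Variables (vs us ws zs : nat -> 'cV[R]_n) (alpha beta : nat -> R).
Hypothesis eps_ge0 : 0 <= eps.
Hypothesis eps_le : k%:R * eps <= 20^-1.
Hypothesis k_gt0 : (0 < k)%N.
Hypothesis run : lanczos_run k eps A v vs us ws zs alpha beta.

Local Notation a := (specnorm A).

Let a_ge0 : 0 <= a := specnorm_ge0 A.

Let k_ge1 : 1 <= k%:R :> R.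
Proof. by rewrite ler1n. Qed.

Let eps20 : eps <= 20^-1.
Proof. by apply: le_trans eps_le; rewrite ler_peMl. Qed.

Let basics : [/\ 0 <= eps, eps <= 20^-1, 0 <= a & a <= a * k%:R].
Proof. by rewrite ler_peMr. Qed.

(** For p > 1 the normalization of v_p comes from step p - 1, which did not terminate because p - 1
    < k. *)
Lemma run_norm p : (1 <= p <= k)%N -> `|dotv (vs p) (vs p) - 1| <= eps.
Proof.
case: p => [//|[|p]] pk; first exact: lanczos_v1_norm run.
have pk' : (1 <= p.+1 <= k)%N by rewrite /= ltnW.
have [z0|zn0] := eqVneq (zs p.+1) 0.
  by have := lanczos_stop_last run pk' z0 => e; move: pk; rewrite e ltnn.
by have [] := lanczos_next run pk' zn0.
Qed.

Lemma enorm_of_dotv (x : 'cV[R]_n) : `|dotv x x - 1| <= eps ->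
  1 - eps <= enorm x <= 1 + eps.
Proof.
have [e0 e20 a0 aak] := basics.
rewrite -enorm_sqr ler_distl => /andP[lo hi]; apply/andP; split.
  rewrite -ler_sqr ?nnegrE ?enorm_ge0 //; last lra.
  apply: le_trans lo; rewrite expr2 ler_piMr; lra.
rewrite -ler_sqr ?nnegrE ?enorm_ge0 //; last lra.
apply: le_trans hi _; rewrite expr2 ler_peMr; lra.
Qed.

Lemma run_enorm p : (1 <= p <= k)%N -> 1 - eps <= enorm (vs p) <= 1 + eps.
Proof. by move=> pk; apply: enorm_of_dotv; exact: run_norm. Qed.

Lemma run_beta_ge0 p : (p <= k)%N -> 0 <= beta p.
Proof.
case: p => [|p] pk; first by rewrite (lanczos_beta0 run).
have [z0|zn0] := eqVneq (zs p.+1) 0.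
  by rewrite (lanczos_stop run _ z0) ?pk.
by have [/ltW] := lanczos_next run (j := p.+1) pk zn0.
Qed.

(** Termination is included, with zero error, following the convention beta_k v_(k+1) = 0. *)
Lemma run_next p : (1 <= p <= k)%N ->
  exists2 D, beta p *: vs p.+1 = zs p + D & enorm D <= eps * enorm (zs p).
Proof.
move=> pk; have [z0|zn0] := eqVneq (zs p) 0.
  by exists 0; rewrite ?(lanczos_stop run pk z0) z0 ?scale0r ?addr0 // !enorm0 mulr0.
by have [] := lanczos_next run pk zn0.
Qed.

Lemma run_next_enorm p : (1 <= p <= k)%N ->
  beta p * (1 - eps) <= enorm (beta p *: vs p.+1) <= beta p * (1 + eps).
Proof.
move=> pk; have [z0|zn0] := eqVneq (zs p) 0.
  by rewrite (lanczos_stop run pk z0) !mul0r scale0r enorm0 lexx.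
have [b0 _ /enorm_of_dotv /andP[lo hi]] := lanczos_next run pk zn0.
by rewrite enormZ gtr0_norm // !ler_pM2l // lo.
Qed.

Lemma run_prev_enorm p : (1 <= p <= k)%N ->
  beta p.-1 * enorm (vs p.-1) <= beta p.-1 * (1 + eps).
Proof.
case: p => [//|[|p]] /= pk; first by rewrite (lanczos_beta0 run) !mul0r.
rewrite ler_wpM2l ?run_beta_ge0 ?(ltnW pk) //.
by have /andP[] := @run_enorm p.+1 (ltnW pk).
Qed.

(** * Growth of the computed quantities *)

Lemma run_u_enorm p : (1 <= p <= k)%N ->
  enorm (us p) <= (1 + eps) * ((1 + eps) * a).
Proof.
have [e0 e20 a0 aak] := basics.
move=> pk; have [eu -> heu] := lanczos_u run pk.
have /andP[_ hv] := run_enorm pk.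
apply: le_trans (enormD _ _) _.
have h1 := enorm_mulmx_le A (vs p).
apply: (@le_trans _ _ ((1 + eps) * (a * enorm (vs p)))); first lra.
by rewrite ler_wpM2l ?addr_ge0 // mulrC ler_wpM2r.
Qed.

Lemma run_w_enorm p : (1 <= p <= k)%N ->
  enorm (ws p) <= (1 + eps) ^+ 2 * ((1 + eps) * a + beta p.-1).
Proof.
have [e0 e20 a0 aak] := basics.
move=> pk; have [ew -> hew] := lanczos_w run pk.
have hu := run_u_enorm pk; have hb := run_prev_enorm pk.
have b0 : 0 <= beta p.-1.
  by apply: run_beta_ge0; case/andP: pk => _; apply: leq_trans; exact: leq_pred.
have e : enorm (us p - beta p.-1 *: vs p.-1) <=
    enorm (us p) + beta p.-1 * enorm (vs p.-1).
  by apply: le_trans (enormB _ _) _; rewrite enormZ ger0_norm.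
apply: le_trans (enormD _ _) _.
apply: (@le_trans _ _ ((1 + eps) * (enorm (us p) + beta p.-1 * enorm (vs p.-1)))).
  lra.
rewrite expr2 -mulrA ler_wpM2l ?addr_ge0 //; lra.
Qed.

Lemma run_sqr_enorm p : (1 <= p <= k)%N -> enorm (vs p) ^+ 2 <= 21 / 20.
Proof.
have [e0 e20 a0 aak] := basics.
by rewrite enorm_sqr => /run_norm; rewrite ler_distl => /andP[_ ?]; lra.
Qed.

Lemma run_alpha_le p : (1 <= p <= k)%N ->
  `|alpha p| * enorm (vs p) <= 6 / 5 * enorm (ws p).
Proof.
have [e0 e20 a0 aak] := basics.
move=> pk; have [ea -> hea] := lanczos_alpha run pk.
have cs := cauchy_schwarz_dotv (vs p) (ws p).
have h : `|dotv (vs p) (ws p) + ea| <= 21 / 20 * (enorm (vs p) * enorm (ws p)).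
  apply: le_trans (ler_normD _ _) _.
  have := ler_wpM2r (mulr_ge0 (enorm_ge0 (vs p)) (enorm_ge0 (ws p))) eps20; lra.
apply: le_trans (ler_wpM2r (enorm_ge0 _) h) _.
have := ler_wpM2r (enorm_ge0 (ws p)) (run_sqr_enorm pk).
have := enorm_ge0 (ws p); rewrite expr2; lra.
Qed.

(** Trades the computed [alpha p] for the exact inner product, so that z_p is an exact projection
    step up to an error of order eps. *)
Lemma run_z_error p : (1 <= p <= k)%N ->
  exists2 E, zs p = ws p - dotv (vs p) (ws p) *: vs p + E &
    enorm E <= 4 * (eps * enorm (ws p)).
Proof.
have [e0 e20 a0 aak] := basics.
move=> pk; have [ea hal hea] := lanczos_alpha run pk.
have [ez -> hez] := lanczos_z run pk.
exists (ez - ea *: vs p).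
  by rewrite hal; apply/colP => i; rewrite !mxE; ring.
apply: le_trans (enormB _ _) _; rewrite enormZ.
have h1 : `|ea| * enorm (vs p) <= 21 / 20 * (eps * enorm (ws p)).
  apply: le_trans (ler_wpM2r (enorm_ge0 _) hea) _.
  have := ler_wpM2l (mulr_ge0 eps_ge0 (enorm_ge0 (ws p))) (run_sqr_enorm pk).
  rewrite expr2; lra.
have h2 := ler_wpM2l eps_ge0 (run_alpha_le pk).
have := mulr_ge0 eps_ge0 (enorm_ge0 (ws p)); lra.
Qed.

(** The factor must be 1 + O(eps), because it compounds over the steps in [run_beta_le]. Subtracting
    (v . w) v changes |w|^2 by (v . w)^2 (|v|^2 - 2), which is not positive. *)
Lemma run_z_enorm p : (1 <= p <= k)%N ->
  enorm (zs p) <= (1 + 4 * eps) * enorm (ws p).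
Proof.
have [e0 e20 a0 aak] := basics.
move=> pk; have [E -> hE] := run_z_error pk.
have proj : enorm (ws p - dotv (vs p) (ws p) *: vs p) <= enorm (ws p).
  rewrite -ler_sqr ?nnegrE ?enorm_ge0 // !enorm_sqr !dotvP (dotvC (ws p) (vs p)).
  have h : dotv (vs p) (vs p) <= 2.
    by have := run_sqr_enorm pk; rewrite enorm_sqr; lra.
  have := ler_wpM2l (sqr_ge0 (dotv (vs p) (ws p))) h; rewrite expr2; lra.
apply: le_trans (enormD _ _) _; lra.
Qed.

Lemma run_beta_step p : (1 <= p <= k)%N ->
  beta p <= (1 + 10 * eps) * (beta p.-1 + 2 * a).
Proof.
have [e0 e20 a0 aak] := basics.
move=> pk; have [D eD hD] := run_next pk.
have /andP[lo _] := run_next_enorm pk.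
have b0 : 0 <= beta p.-1.
  by apply: run_beta_ge0; case/andP: pk => _; apply: leq_trans; exact: leq_pred.
have hz := run_z_enorm pk; have hw := run_w_enorm pk.
have e1 : 0 < 1 - eps by lra.
rewrite -(ler_pM2r e1); apply: le_trans lo _; rewrite eD.
have {eD hD} : enorm (zs p + D) <= (1 + eps) * enorm (zs p).
  by apply: le_trans (enormD _ _) _; lra.
move/le_trans; apply.
have q1 : 0 <= 1 + eps by lra.
have q4 : 0 <= 1 + 4 * eps by lra.
apply: le_trans (ler_wpM2l q1 hz) _; rewrite mulrA.
apply: le_trans (ler_wpM2l (mulr_ge0 q1 q4) hw) _; rewrite mulrA.
rewrite [leRHS]mulrAC; apply: ler_pM.
- by rewrite mulr_ge0 ?exprn_ge0 // mulr_ge0.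
- by rewrite addr_ge0 // mulr_ge0.
(* The claim is (1 + eps)^3 (1 + 4 eps) <= (1 + 10 eps) (1 - eps); higher powers of eps are absorbed
   into the linear slack 7 < 9. *)
- have e2 : eps * eps <= 20^-1 * eps by rewrite ler_wpM2r.
  have e3 : eps * (eps * eps) <= 20^-1 * (eps * eps).
    by rewrite ler_wpM2r ?mulr_ge0.
  have e4 : eps * (eps * (eps * eps)) <= 20^-1 * (eps * (eps * eps)).
    by rewrite ler_wpM2r ?mulr_ge0.
  rewrite !expr2; lra.
- have := ler_wpM2r a_ge0 eps20; lra.
Qed.

(** Unrolling [run_beta_step] gives linear growth times (1 + 10 eps)^p, and k eps <= 1/20 keeps that
    power at most 2. *)
Lemma run_beta_le p : (p <= k)%N -> beta p <= 4 * (a * k%:R).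
Proof.
have [e0 e20 a0 aak] := basics.
move=> pk.
have growth : beta p <= (1 + 10 * eps) ^+ p * (2 * a * p%:R).
  elim: p pk => [|p IH] pk; first by rewrite (lanczos_beta0 run) !mulr0.
  apply: le_trans (run_beta_step (p := p.+1) pk) _; rewrite exprS -mulrA.
  have q1 : 1 <= 1 + 10 * eps by lra.
  rewrite ler_wpM2l //=; first by lra.
  have h := IH (ltnW pk).
  have : 2 * a <= (1 + 10 * eps) ^+ p * (2 * a).
    by rewrite ler_peMl ?mulr_ge0 // exprn_ege1.
  rewrite -[p.+1%:R]natr1; lra.
(* Bernoulli's inequality for (1 + x)^p (1 - p x) <= 1 with p x <= 1/2. *)
have bernoulli : (1 + 10 * eps) ^+ p * (1 - p%:R * (10 * eps)) <= 1.
  elim: p {pk growth} => [|p IH]; first by rewrite expr0 mul0r subr0 mulr1.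
  apply: le_trans IH; rewrite exprSr -mulrA ler_wpM2l ?exprn_ge0 //; first by lra.
  have := mulr_ge0 (ler0n R p) (mulr_ge0 eps_ge0 eps_ge0).
  have := mulr_ge0 eps_ge0 eps_ge0.
  rewrite -natr1; lra.
have pk' : p%:R <= k%:R :> R by rewrite ler_nat.
have pe : p%:R * eps <= 20^-1 by apply: le_trans eps_le; rewrite ler_wpM2r.
have two : (1 + 10 * eps) ^+ p <= 2.
  have x0 : 0 <= (1 + 10 * eps) ^+ p by rewrite exprn_ge0; lra.
  have half : 2^-1 <= 1 - p%:R * (10 * eps) by lra.
  have := ler_wpM2l x0 half; lra.
apply: le_trans growth _.
apply: (@le_trans _ _ (2 * (2 * a * p%:R))).
  by rewrite ler_wpM2r // !mulr_ge0.
have := ler_wpM2l a_ge0 pk'; lra.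
Qed.

Lemma run_w_le p : (1 <= p <= k)%N -> enorm (ws p) <= 6 * (a * k%:R).
Proof.
have [e0 e20 a0 aak] := basics.
move=> pk; apply: le_trans (run_w_enorm pk) _.
have hb : beta p.-1 <= 4 * (a * k%:R).
  by apply: run_beta_le; case/andP: pk => _; apply: leq_trans; exact: leq_pred.
have h1 : (1 + eps) * a <= 21 / 20 * a by rewrite ler_wpM2r //; lra.
have h2 : (1 + eps) ^+ 2 <= 9 / 8.
  by have := ler_wpM2r eps_ge0 eps20; rewrite expr2; lra.
have b0 : 0 <= beta p.-1.
  by apply: run_beta_ge0; case/andP: pk => _; apply: leq_trans; exact: leq_pred.
have s0 : 0 <= (1 + eps) * a + beta p.-1.
  by rewrite addr_ge0 // mulr_ge0 // addr_ge0.
apply: le_trans (ler_wpM2r s0 h2) _; lra.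
Qed.

(** * Recurrence defect, local orthogonality and norm variation *)

Definition run_defect p : 'cV[R]_n :=
  A *m vs p - (beta p.-1 *: vs p.-1 + alpha p *: vs p + beta p *: vs p.+1).

Lemma run_recurrence p :
  A *m vs p = beta p.-1 *: vs p.-1 + alpha p *: vs p + beta p *: vs p.+1 +
              run_defect p.
Proof. by rewrite /run_defect addrC subrK. Qed.

Lemma run_defect_le p : (1 <= p <= k)%N ->
  enorm (run_defect p) <= 30 * (eps * (a * k%:R)).
Proof.
have [e0 e20 a0 aak] := basics.
move=> pk; have [D eD hD] := run_next pk.
have [eu eU hu] := lanczos_u run pk; have [ew eW hw] := lanczos_w run pk.
have [ez eZ hz] := lanczos_z run pk.
(* The defect collects the four rounding errors of one step; their bounds below add up to 8 + 27/2 +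
   6 + 21/20 < 30. *)
have -> : run_defect p = - (D + ez + (ew + eu)).
  rewrite /run_defect eD eZ eW eU.
  by apply/colP => i; rewrite !mxE; ring.
rewrite enormN; apply: le_trans (enormD _ _) _.
have h1 := enormD D ez; have h2 := enormD ew eu.
have W := run_w_le pk; have Z := run_z_enorm pk.
have AL := run_alpha_le pk; have U := run_u_enorm pk.
have PB := run_prev_enorm pk; have /andP[_ V] := run_enorm pk.
have pk' : (p.-1 <= k)%N.
  by case/andP: pk => _; apply: leq_trans; exact: leq_pred.
have B := run_beta_le pk'; have B0 := run_beta_ge0 pk'.
have hD' : enorm D <= eps * (8 * (a * k%:R)).
  apply: le_trans hD _; rewrite ler_wpM2l //.
  have := ler_wpM2r (enorm_ge0 (ws p)) eps20; lra.
have hz' : enorm ez <= eps * (27 / 2 * (a * k%:R)).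
  by apply: le_trans hz _; rewrite ler_wpM2l //; lra.
have hw' : enorm ew <= eps * (6 * (a * k%:R)).
  apply: le_trans hw _; rewrite ler_wpM2l //.
  have := ler_wpM2r B0 eps20; have := ler_wpM2r a_ge0 eps20.
  have := ler_wpM2r (mulr_ge0 eps_ge0 a_ge0) eps20; lra.
have hu' : enorm eu <= eps * (21 / 20 * (a * k%:R)).
  apply: le_trans hu _; rewrite -mulrA ler_wpM2l //.
  have v1 : enorm (vs p) <= 21 / 20 by lra.
  have := ler_wpM2l a_ge0 v1; lra.
have := mulr_ge0 eps_ge0 (mulr_ge0 a_ge0 (ler0n R k)); lra.
Qed.

(** Pairing v_p with the projection step leaves (1 - |v_p|^2) (v_p . w_p) and rounding errors, all
    of order eps |w_p|. *)
Lemma run_local_orthogonality p : (1 <= p <= k)%N ->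
  `|beta p * dotv (vs p) (vs p.+1)| <= 40 * (eps * (a * k%:R)).
Proof.
have [e0 e20 a0 aak] := basics.
move=> pk; have [D eD hD] := run_next pk; have [E eE hE] := run_z_error pk.
rewrite -dotvZr eD eE.
have -> : dotv (vs p) (ws p - dotv (vs p) (ws p) *: vs p + E + D) =
    - ((dotv (vs p) (vs p) - 1) * dotv (vs p) (ws p)) + dotv (vs p) (E + D).
  by rewrite !dotvP; ring.
apply: le_trans (ler_normD _ _) _; rewrite normrN normrM.
have W := run_w_le pk; have Z := run_z_enorm pk.
have /andP[_ V] := run_enorm pk.
have v1 : enorm (vs p) <= 21 / 20 by lra.
have w0 := enorm_ge0 (ws p).
have t1 : `|dotv (vs p) (vs p) - 1| * `|dotv (vs p) (ws p)| <=
    eps * (21 / 20 * enorm (ws p)).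
  apply: ler_pM => //; first exact: run_norm.
  by apply: le_trans (cauchy_schwarz_dotv _ _) _; rewrite ler_wpM2r.
have DE : enorm (E + D) <= eps * (21 / 4 * enorm (ws p)).
  apply: le_trans (enormD _ _) _.
  have e4 := ler_wpM2r w0 eps20.
  have z2 : enorm (zs p) <= 6 / 5 * enorm (ws p) by lra.
  have := ler_wpM2l eps_ge0 z2; have := mulr_ge0 eps_ge0 w0; lra.
have t2 : `|dotv (vs p) (E + D)| <= 21 / 20 * (eps * (21 / 4 * enorm (ws p))).
  apply: le_trans (cauchy_schwarz_dotv _ _) _.
  by apply: ler_pM; rewrite ?enorm_ge0.
have := ler_wpM2l eps_ge0 W; have := mulr_ge0 eps_ge0 w0; lra.
Qed.

(** Both squared norms lie within eps of 1. The constant 40 is generous, so that a single [psi]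
    covers this bound and local orthogonality. *)
Lemma run_norm_variation p : (1 <= p < k)%N ->
  `|beta p * (dotv (vs p.+1) (vs p.+1) - dotv (vs p) (vs p))| <=
  40 * (eps * (a * k%:R)).
Proof.
have [e0 e20 a0 aak] := basics.
move=> /andP[p1 pk]; have b0 := run_beta_ge0 (ltnW pk).
rewrite normrM ger0_norm //.
have h : `|dotv (vs p.+1) (vs p.+1) - dotv (vs p) (vs p)| <= 2 * eps.
  have := @run_norm p.+1 pk; have := @run_norm p; rewrite p1 ltnW // => /(_ isT).
  rewrite !ler_norml => /andP[? ?] /andP[? ?]; apply/andP; split; lra.
apply: le_trans (ler_wpM2l b0 h) _.
have := ler_wpM2r eps_ge0 (run_beta_le (ltnW pk)).
have := mulr_ge0 eps_ge0 (mulr_ge0 a_ge0 (ler0n R k)); lra.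
Qed.

Lemma run_last_residual : enorm (beta k *: vs k.+1) <= 2 * beta k.
Proof.
have [e0 e20 a0 aak] := basics.
have kk : (1 <= k <= k)%N by rewrite k_gt0 leqnn.
have /andP[_ /le_trans] := run_next_enorm kk; apply.
have := ler_wpM2l (run_beta_ge0 (leqnn k)) eps20.
have := run_beta_ge0 (leqnn k); lra.
Qed.

(** With phi = 30 x k and psi = 40 x k for x = eps |A|, the term k (20 k^2 h) equals 1600 k^5 x +
    2400 k^6 x, whence the constant 4000 and the exponent 6. *)
Lemma run_ritz_value (theta : R) (y : 'cV[R]_k) : A^T = A ->
  tridiag k alpha beta *m y = theta *: y -> enorm y = 1 ->
  exists2 l, eigenvalue A l &
    `|theta - l| <=
    4000 * k%:R ^+ 6 * (beta k * `|dotv (stdvec R k k) y| + eps * a).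
Proof.
have [e0 e20 a0 aak] := basics.
move=> symA Ty y1.
have ea0 : 0 <= eps * (a * k%:R) by rewrite !mulr_ge0.
have kk : (1 <= k <= k)%N by rewrite k_gt0 leqnn.
have norms p : (1 <= p <= k)%N -> `|dotv (vs p) (vs p) - 1| <= 20^-1.
  by move=> /run_norm/le_trans; apply.
have orth p : (1 <= p < k)%N ->
    `|beta p * dotv (vs p) (vs p.+1)| <= 40 * (eps * (a * k%:R)).
  by move=> /andP[p1 pk]; apply: run_local_orthogonality; rewrite p1 ltnW.
have [l Al hl] := ritz_value_near_spectrum symA (lanczos_beta0 run) run_beta_ge0
  (fun p _ => run_recurrence p) (mulr_ge0 (ler0n R 30) ea0)
  (mulr_ge0 (ler0n R 40) ea0) run_defect_le norms run_last_residual orth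
  run_norm_variation kk Ty y1.
exists l => //; apply: le_trans hl _.
have -> : dotv (stdvec R k k) y = vcoef y k.
  have := vcoef_sum_delta y k.-1; rewrite prednK // dotvE => <-.
  apply: eq_bigr => i _; rewrite mxE; congr (_%:R * _).
  by rewrite -[in RHS]eqSS prednK // eq_sym.
have b0 : 0 <= beta k * `|vcoef y k| by rewrite mulr_ge0 ?run_beta_ge0.
have ea : 0 <= eps * a by rewrite mulr_ge0.
move: (beta k * _) b0 => b b0; move: (eps * a) ea {ea0} (mulrA eps a k%:R).
move=> x x0 ->; move: (k%:R : R) k_ge1 => K K1.
have K6 : 1 <= K ^+ 6 by rewrite exprn_ege1.
have K5 : K ^+ 5 <= K ^+ 6 by rewrite ler_weXn2l.
have := ler_wpM2r b0 K6; have := ler_wpM2r x0 K5.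
rewrite (_ : K * _ = 1600 * (K ^+ 5 * x) + 2400 * (K ^+ 6 * x)); last by ring.
lra.
Qed.

End FinitePrecisionRun.

(** * Distance to the spectrum and conclusion *)

Lemma edist_inf_le (R : realType) (S : set R) (x l r : R) : S l ->
  `|x - l| <= r -> (edist_inf S x <= r%:E)%E.
Proof.
move=> Sl xl; apply: (@le_trans _ _ (edist (x, l))).
  by apply: ereal_inf_lbound; exists l.
(* [edist] is bounded through open balls, so a non-strict inequality is reached by allowing every
   slack e > 0. *)
apply/lee_addgt0Pr => e e0; rewrite -EFinD; apply: edist_fin.
  by rewrite ltr_wpDl // (le_trans (normr_ge0 _) xl).
by rewrite /ball /= /ball_ /= (le_lt_trans xl) // ltrDl.
Qed.

Theorem theorem3p9 (R : realType) :
  exists c d : R, [/\ 0 < c, 0 < d &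
    forall (n kmax k : nat) (eps : R) (A : 'M[R]_n) (v : 'cV[R]_n)
      (vs us ws zs : nat -> 'cV[R]_n) (alpha beta : nat -> R),
      (1 <= n)%N -> (1 <= kmax)%N -> (1 <= k <= kmax)%N ->
      A^T = A -> v != 0 ->
      0 <= eps <= 1 / (20 * kmax%:R) ->
      lanczos_run k eps A v vs us ws zs alpha beta ->
      let T := tridiag k alpha beta in
      (forall (theta : R) (y : 'cV[R]_k),
         T *m y = theta *: y -> enorm y = 1 ->
         (edist_inf (spec A) theta <=
          (c * (k%:R `^ d) *
           (beta k * `|dotv (stdvec R k k) y| + eps * specnorm A))%:E)%E) /\
      (zs k = 0 -> forall theta : R, spec T theta ->
         (edist_inf (spec A) theta <=
          (c * (k%:R `^ d) * (eps * specnorm A))%:E)%E)].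
Proof.
exists 4000, 6%:R; split; [lra | lra | ].
move=> n kmax k eps A v vs us ws zs alpha beta _ kmax0 /andP[k0 kk] symA _.
move=> /andP[eps0 epsle] run T.
have keps : k%:R * eps <= 20^-1.
  have kp : 0 < kmax%:R :> R by rewrite ltr0n.
  have h := ler_wpM2l (ler0n R kmax) epsle.
  have e : kmax%:R * (1 / (20 * kmax%:R)) = 20^-1 :> R by field; rewrite gt_eqF.
  by rewrite e in h; apply: le_trans h; rewrite ler_wpM2r // ler_nat.
have main theta y : T *m y = theta *: y -> enorm y = 1 ->
   (edist_inf (spec A) theta <=
    (4000 * (k%:R `^ 6%:R) *
      (beta k * `|dotv (stdvec R k k) y| + eps * specnorm A))%:E)%E.
  move=> Ty y1; have [l Al hl] := run_ritz_value eps0 keps k0 run symA Ty y1.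
  by apply: (edist_inf_le (l := l)) => //; rewrite powR_mulrn.
split=> // zk0 theta /eigenvalueP [x xT xn0].
(* [eigenvalue] supplies a row eigenvector; as T is symmetric, its normalized transpose is a unit
   column eigenvector. *)
pose y := (enorm x^T)^-1 *: x^T.
have xT0 : x^T != 0 by apply: contra xn0 => /eqP e; rewrite -[x]trmxK e trmx0.
have Ty : T *m y = theta *: y.
  rewrite /y -scalemxAr -(tr_tridiag k alpha beta : T^T = T) -trmx_mul xT linearZ /=.
  by rewrite !scalerA mulrC.
have y1 : enorm y = 1.
  rewrite /y enormZ ger0_norm ?invr_ge0 ?enorm_ge0 // mulVf //.
  by rewrite enorm_eq0.
have bk : beta k = 0 by apply: (lanczos_stop run) => //; rewrite k0 leqnn.
by have := main _ _ Ty y1; rewrite bk mul0r add0r.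
Qed.
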